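(* Let $\boldsymbol\alpha\in\mathbb{N}^m$, $\boldsymbol\beta\in\mathbb{N}^n$ with $\sum_i\alpha_i=\sum_j\beta_j$, and suppose $\alpha_i,\beta_j\le c$ for all $i,j\ge2$. Let $K=(k_{ij})$ with $k_{ij}=\min(\alpha_i,\beta_j)$. Then \[ \mathrm{cap}_{\boldsymbol\alpha\,\boldsymbol\beta}(P_K)\ge\mathrm{CT}(\boldsymbol\alpha,\boldsymbol\beta)\ge\frac{1}{(m+n-1)\,(e(c+1))^{m+n-1}}\,\mathrm{cap}_{\boldsymbol\alpha\,\boldsymbol\beta}(P_K). \]
   Context: $\mathrm{CT}(\boldsymbol\alpha,\boldsymbol\beta)$ is the number of $m\times n$ matrices with nonnegative integer entries, row sums $\alpha_i$ and column sums $\beta_j$. For a matrix $K=(k_{ij})$ with entries in $\mathbb{N}$, $P_K(\mathbf{x},\mathbf{y})=\prod_{i=1}^m\prod_{j=1}^n\sum_{\ell=0}^{k_{ij}}x_i^\ell y_j^\ell$, and $\mathrm{cap}_{\boldsymbol\alpha\,\boldsymbol\beta}(F)=\inf_{\mathbf{x}>0,\mathbf{y}>0}F(\mathbf{x},\mathbf{y})\prod_i x_i^{-\alpha_i}\prod_j y_j^{-\beta_j}$. *)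

(* Defs.v *)
From mathcomp Require Import all_boot all_order all_algebra finmap.
From mathcomp Require Import all_classical all_reals all_analysis.

Set Implicit Arguments.
Unset Strict Implicit.
Unset Printing Implicit Defensive.

Import Order.TTheory GRing.Theory Num.Theory.
Local Open Scope classical_set_scope.
Local Open Scope ring_scope.

Definition contingency_tables (m n : nat) (alpha : 'I_m -> nat)
    (beta : 'I_n -> nat) : set 'M[nat]_(m, n) :=
  [set A | (forall i, (\sum_j A i j)%N = alpha i) /\
           (forall j, (\sum_i A i j)%N = beta j)].

(* [fset_set] is the empty set on infinite sets; this case never occurs here, *)
(* see [finite_contingency_tables].                                           *)
Definition CT (m n : nat) (alpha : 'I_m -> nat) (beta : 'I_n -> nat) : nat :=
  #|` fset_set (contingency_tables alpha beta)|.

Definition P_ (R : realType) (m n : nat) (K : 'M[nat]_(m, n))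
    (x : 'I_m -> R) (y : 'I_n -> R) : R :=
  \prod_(i < m) \prod_(j < n) \sum_(l < (K i j).+1) x i ^+ l * y j ^+ l.

Definition cap_values (R : realType) (m n : nat) (alpha : 'I_m -> nat)
    (beta : 'I_n -> nat) (F : ('I_m -> R) -> ('I_n -> R) -> R) : set R :=
  [set r | exists x y, [/\ forall i, 0 < x i, forall j, 0 < y j &
     r = F x y * (\prod_i x i ^- alpha i) * (\prod_j y j ^- beta j)]].

(* [inf] is 0 on sets that are empty or not bounded below; for [F := P_ K] it *)
(* is a genuine infimum, see [has_inf_cap_values].                            *)
Definition cap (R : realType) (m n : nat) (alpha : 'I_m -> nat)
    (beta : 'I_n -> nat) (F : ('I_m -> R) -> ('I_n -> R) -> R) : R :=
  inf (cap_values alpha beta F).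

Lemma finite_contingency_tables (m n : nat) (alpha : 'I_m -> nat)
    (beta : 'I_n -> nat) : finite_set (contingency_tables alpha beta).
Proof.
pose N := (\sum_i alpha i)%N.
pose f (B : 'M['I_N.+1]_(m, n)) : 'M[nat]_(m, n) := map_mx (@nat_of_ord _) B.
apply: (@sub_finite_set _ _ (f @` [set: 'M['I_N.+1]_(m, n)])); last first.
  exact/finite_image/finite_finset.
move=> A [rowA _]; exists (map_mx inord A) => //.
apply/matrixP => i j; rewrite !mxE inordK// ltnS.
apply: (@leq_trans (alpha i)); last by rewrite /N (bigD1 i)//= leq_addr.
by rewrite -rowA (bigD1 j)//= leq_addr.
Qed.

Lemma has_inf_cap_values (R : realType) (m n : nat) (alpha : 'I_m -> nat)
    (beta : 'I_n -> nat) (K : 'M[nat]_(m, n)) :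
  has_inf (cap_values alpha beta (@P_ R m n K)).
Proof.
split; first by eexists; exists (fun=> 1), (fun=> 1); split.
exists 0 => _ [x [y [x0 y0 ->]]].
rewrite !mulr_ge0//; last 2 first.
- by apply: prodr_ge0 => i _; rewrite invr_ge0 exprn_ge0// ltW.
- by apply: prodr_ge0 => i _; rewrite invr_ge0 exprn_ge0// ltW.
apply: prodr_ge0 => i _; apply: prodr_ge0 => j _; apply: sumr_ge0 => l _.
by rewrite mulr_ge0// exprn_ge0// ltW.
Qed.

(* Main.v *)
Require Import Defs.
From mathcomp Require Import all_boot all_order all_algebra finmap.
From mathcomp Require Import all_classical all_reals all_analysis.
From mathcomp Require Import ring lra zify.

Set Implicit Arguments.
Unset Strict Implicit.
Unset Printing Implicit Defensive.

Import Order.TTheory GRing.Theory Num.Theory numFieldNormedType.Exports.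
Local Open Scope ring_scope.

(** The upper bound on [CT] is the expansion of [P_K] into monomials.

    For the lower bound one builds a point [(x, y)] one coordinate at a time,
    each time extracting one coefficient. If [a_0, ..., a_M] is positive and
    log-concave, it lies below a geometric sequence through [a_k], hence
    [\sum_l a_l t^l <= e (k + 1) a_k t^k] for a suitable [t > 0]. Extracting
    first the columns turns [P_K] into [\prod_j h_{beta_j}(x)], with [h] the
    complete homogeneous symmetric polynomials; extracting then the rows other
    than the first one turns this product into [CT]. In the first column the
    factor [e (beta_1 + 1)] is replaced by [e (\sum_(i >= 2) alpha_i + 1)].

    Log-concavity comes from a Lorentzian property: for an array [c] on [Z^I],
    the forms [\sum_(a, b) c (g + e_a + e_b) v_a v_b] are nonpositive on a
    hyperplane. It is preserved by
    [c |-> \sum_l z^l c (g - l (e_i - e_j))], which multiplies the generating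
    series by [1 / (1 - z x_i / x_j)], so starting from a point mass it holds for
    weighted counts of contingency tables. *)

(** * Arrays with Lorentzian Hessians *)

Section Hessian.
Variables (R : realFieldType) (I : finType).
Implicit Types (c : {ffun I -> int} -> R) (g : {ffun I -> int}) (u v w : I -> R).

Definition unitv (a : I) : {ffun I -> int} := [ffun b => (b == a)%:R].

Definition hess c g v w : R :=
  \sum_a \sum_b c (g + unitv a + unitv b) * v a * w b.

(** At most one positive eigenvalue, phrased through a hyperplane so that no spectral theory is
    involved. The case [phi = 0] means that the form is nonpositive everywhere. *)
Definition lorentzian_at c g :=
  exists phi : I -> R, forall v, \sum_a phi a * v a = 0 -> hess c g v v <= 0.

Lemma hessC c g v w : hess c g v w = hess c g w v.
Proof.
rewrite /hess exchange_big; apply: eq_bigr => a _; apply: eq_bigr => b _.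
by rewrite addrAC mulrAC.
Qed.

Lemma hess_linr c g w p u q v :
  hess c g w (fun a => p * u a + q * v a) = p * hess c g w u + q * hess c g w v.
Proof.
rewrite /hess !mulr_sumr -big_split; apply: eq_bigr => a _ /=.
rewrite !mulr_sumr -big_split; apply: eq_bigr => b _ /=; ring.
Qed.

Lemma hess_comb c g p u q v (w := fun a => p * u a + q * v a) :
  hess c g w w =
  p ^+ 2 * hess c g u u + 2 * p * q * hess c g u v + q ^+ 2 * hess c g v v.
Proof.
rewrite /w hess_linr (hessC _ _ _ u) (hessC _ _ _ v) !hess_linr.
rewrite (hessC _ _ v u); ring.
Qed.

Definition basisv (a b : I) : R := (b == a)%:R.

Lemma hess_basisl c g a v :
  hess c g (basisv a) v = \sum_b c (g + unitv a + unitv b) * v b.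
Proof.
rewrite /hess (bigD1 a)//= [X in _ + X]big1 ?addr0 => [|b ba].
  by apply: eq_bigr => b _; rewrite /basisv eqxx mulr1.
by apply: big1 => d _; rewrite /basisv (negbTE ba) mulr0 mul0r.
Qed.

Lemma hess_basis c g a b :
  hess c g (basisv a) (basisv b) = c (g + unitv a + unitv b).
Proof.
rewrite hess_basisl (bigD1 b)//= big1 ?addr0 => [|d db].
  by rewrite /basisv eqxx mulr1.
by rewrite /basisv (negbTE db) mulr0.
Qed.

(** Otherwise the form would be positive definite on the span of [u] and [v], a plane that meets the
    hyperplane of [phi] nontrivially. *)
Lemma lorentzian_reverse_CS c g u v : lorentzian_at c g ->
  0 <= hess c g u u -> hess c g u u * hess c g v v <= hess c g u v ^+ 2.
Proof.
move=> [phi neg] A0.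
set A := hess c g u u in A0 *; set B := hess c g u v; set C := hess c g v v.
have [C0|C0] := lerP C 0.
  by apply: (@le_trans _ _ 0); [exact: mulr_ge0_le0 | exact: sqr_ge0].
pose p := \sum_a phi a * u a; pose q := \sum_a phi a * v a.
have : hess c g (fun a => q * u a + - p * v a) (fun a => q * u a + - p * v a) <= 0.
  apply: neg.
  transitivity (q * (\sum_a phi a * u a) - p * (\sum_a phi a * v a)); last first.
    by rewrite -/p -/q mulrC subrr.
  rewrite !mulr_sumr -sumrB; apply: eq_bigr => a _; ring.
rewrite hess_comb -/A -/B -/C => le0.
rewrite leNgt; apply/negP => lt.
have A1 : 0 < A.
  rewrite lt_neqAle A0 andbT; apply/eqP => Az.
  by move: lt; rewrite -Az mul0r ltNge sqr_ge0.
(* [C] times the value of the form at [q u - p v], with the square completed. *)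
have key : (p * C - q * B) ^+ 2 + q ^+ 2 * (A * C - B ^+ 2) <= 0.
  have -> : (p * C - q * B) ^+ 2 + q ^+ 2 * (A * C - B ^+ 2) =
    C * (q ^+ 2 * A + 2 * q * - p * B + (- p) ^+ 2 * C) by ring.
  by rewrite pmulr_rle0.
have [q0|q0] := eqVneq q 0.
  (* If [p] vanishes too, [u] itself lies on the hyperplane, against [0 < A]. *)
  have [p0|p0] := eqVneq p 0.
    by have := neg _ p0; rewrite -/A leNgt A1.
  move: key; rewrite q0 mul0r subr0 expr0n mul0r addr0 leNgt.
  by rewrite exprn_even_gt0//= mulf_neq0// gt_eqF.
move: key; rewrite leNgt ltr_wpDl ?sqr_ge0// mulr_gt0// ?subr_gt0//.
by rewrite exprn_even_gt0.
Qed.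

Lemma lorentzian_log_concave c g a b : lorentzian_at c g ->
  0 <= c (g + unitv a + unitv a) ->
  c (g + unitv a + unitv a) * c (g + unitv b + unitv b) <=
  c (g + unitv a + unitv b) ^+ 2.
Proof.
by move=> L; rewrite -!hess_basis; exact: lorentzian_reverse_CS.
Qed.

(** On the hyperplane [v r = 0] no term of the form survives. *)
Lemma lorentzian_at_star c g r :
  (forall a b, a != r -> b != r -> c (g + unitv a + unitv b) = 0) ->
  lorentzian_at c g.
Proof.
move=> c0; exists (basisv r) => v.
rewrite (bigD1 r)//= {1}/basisv eqxx mul1r big1 ?addr0 => [vr0|a ar]; last first.
  by rewrite /basisv (negbTE ar) mul0r.
rewrite /hess big1// => a _; rewrite big1// => b _.
have [->|ar] := eqVneq a r; first by rewrite vr0 mulr0 mul0r.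
have [->|br] := eqVneq b r; first by rewrite vr0 mulr0.
by rewrite c0// !mul0r.
Qed.

Definition arcv (i j : I) : {ffun I -> int} := unitv i - unitv j.

(* On the hyperplane [hess c' g (e_j, .) = hess c' (g - d) (e_i, .) = 0] both  *)
(* summands of [hess c' g] are bounded by reverse Cauchy-Schwarz, against      *)
(* [e_j] and against [e_i] after a shift along [e_j]; the two bounds cancel.   *)
Lemma lorentzian_geometric_step i j z c c' g : 0 < z ->
  (forall a b, c' (g + unitv a + unitv b) =
     c (g + unitv a + unitv b) + z * c' (g - arcv i j + unitv a + unitv b)) ->
  0 < c (g + unitv j + unitv j) ->
  0 <= c (g + unitv i + unitv j) ->
  0 <= c' (g - arcv i j + unitv j + unitv j) ->
  lorentzian_at c g -> lorentzian_at c' (g - arcv i j) -> lorentzian_at c' g.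
Proof.
move=> z_gt0 rec; set g' := g - arcv i j => p0 p1 Pm1_ge0 Lc Lc'.
have gE b : g + unitv j + unitv b = g' + unitv i + unitv b.
  by apply/ffunP => t; rewrite /g' /arcv !ffunE; ring.
exists (fun b => c' (g + unitv j + unitv b)) => v phi0.
have hE u w : hess c' g u w = hess c g u w + z * hess c' g' u w.
  rewrite /hess mulr_sumr -big_split; apply: eq_bigr => a _ /=.
  rewrite mulr_sumr -big_split; apply: eq_bigr => b _ /=; rewrite rec; ring.
have hi0 : hess c' g' (basisv i) v = 0.
  by rewrite hess_basisl -[RHS]phi0; apply: eq_bigr => b _; rewrite gE.
have hj0 : hess c g (basisv j) v + z * hess c' g' (basisv j) v = 0.
  by rewrite -hE hess_basisl.
set b := hess c' g' (basisv j) v in hj0.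
set a := hess c g (basisv j) v in hj0.
pose P1 := c' (g' + unitv i + unitv i).
pose P0 := c' (g' + unitv i + unitv j).
pose Pm1 := c' (g' + unitv j + unitv j).
pose p := c (g + unitv j + unitv j).
have P0E : P0 = p + z * Pm1 by rewrite /P0 -gE rec.
have P1E : P1 = c (g + unitv i + unitv j) + z * P0.
  by rewrite /P1 -gE addrAC rec.
have P0_gt0 : 0 < P0 by rewrite P0E ltr_wpDr// mulr_ge0// ltW.
have P1_gt0 : 0 < P1 by rewrite P1E ltr_wpDl// mulr_gt0.
have CSj : p * hess c g v v <= a ^+ 2.
  by rewrite /p -hess_basis; apply: lorentzian_reverse_CS; rewrite ?hess_basis ?ltW.
(* By [hi0] the vector [v] is orthogonal to [e_i], so only the shift along [e_j] appears on the
   right; [th] stays free and is optimized at the end. *)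
have CSi th : P1 * (hess c' g' v v + 2 * th * b + th ^+ 2 * Pm1) <= th ^+ 2 * P0 ^+ 2.
  have := @lorentzian_reverse_CS c' g' (basisv i)
    (fun x => 1 * v x + th * basisv j x) Lc'.
  rewrite hess_basis => /(_ (ltW P1_gt0)); rewrite hess_comb hess_linr hi0 !hess_basis.
  by rewrite (hessC _ _ v) -/b -/P1 -/Pm1 -/P0 expr1n !mul1r mulr1 add0r exprMn.
rewrite hE; set X := hess c g v v in CSj *; set Y := hess c' g' v v in CSi *.
have aE : a = - (z * b) by apply/eqP; rewrite -addr_eq0 hj0.
have bnd th : z * Y <= th ^+ 2 * p + 2 * th * a.
  have h1 : P1 * (z * Y) <= z * (th ^+ 2 * P0 ^+ 2) - P1 * (z * (2 * th * b + th ^+ 2 * Pm1)).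
    have := CSi th; rewrite -(ler_pM2l z_gt0); lra.
  have h2 : z * (th ^+ 2 * P0 ^+ 2) <= P1 * (th ^+ 2 * P0).
    have : 0 <= th ^+ 2 * P0 * (P1 - z * P0).
      apply: mulr_ge0; first by rewrite mulr_ge0 ?sqr_ge0// ltW.
      by rewrite P1E addrK.
    lra.
  rewrite -(ler_pM2l P1_gt0) (le_trans h1)//.
  have -> : p = P0 - z * Pm1 by rewrite P0E addrK.
  rewrite aE; lra.
(* This [th] minimizes the right side of [bnd]; the minimum [- (a ^+ 2 / p)] cancels the bound on
   [X] coming from [CSj]. *)
have := bnd (- a / p).
have -> : (- a / p) ^+ 2 * p + 2 * (- a / p) * a = - (a ^+ 2 / p).
  by field; rewrite gt_eqF.
move=> zY; have Xle : X <= a ^+ 2 / p by rewrite ler_pdivlMr// mulrC.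
lra.
Qed.

End Hessian.

Section Arrays.
Variables (R : realFieldType) (I : finType) (row : pred I).
Implicit Types (c : {ffun I -> int} -> R) (g : {ffun I -> int}).

Definition rows_ge0 g := [forall r, row r ==> (0 <= g r)].

Lemma rows_ge0P g : reflect (forall r, row r -> 0 <= g r) (rows_ge0 g).
Proof. by apply: (iffP forallP) => h r; [apply/implyP | apply/implyP/h]. Qed.

(** Only coordinates in [row] are confined to nonnegative values. The others range over all
    integers, since passing from [g] to [g - arcv i j] raises the coordinate [j] outside [row]. *)
Record lorentzian_array c : Prop := LorentzianArray {
  array_gt0 : forall g, rows_ge0 g -> 0 < c g;
  array_eq0 : forall g r, row r -> g r < 0 -> c g = 0;
  array_lorentzian : forall g, rows_ge0 g -> lorentzian_at c g }.

Lemma array_ge0 c g : lorentzian_array c -> 0 <= c g.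
Proof.
move=> [cp cz _]; have [/cp/ltW//|] := boolP (rows_ge0 g).
by move=> /forallPn[r]; rewrite negb_imply -ltNge => /andP[rr /cz->].
Qed.

Lemma rows_ge0D g a : rows_ge0 g -> rows_ge0 (g + unitv a).
Proof.
move=> /rows_ge0P h; apply/rows_ge0P => r rr; rewrite !ffunE.
by rewrite addr_ge0// h.
Qed.

(** The full geometric series: for a Lorentzian array and a row [i], the terms with [l > g i]
    vanish, so the cut at the absolute value of [g i] loses nothing. *)
Definition geom (i j : I) (z : R) c g : R :=
  \sum_(l < `|g i|.+1) z ^+ l * c (g - arcv i j *+ l).

Section Geom.
Variables (i j : I) (z : R).
Hypotheses (ri : row i) (rj : ~~ row j) (z_gt0 : 0 < z).

Lemma arcvMnE l r : row r -> (arcv i j *+ l) r = ((r == i) * l)%N%:Z.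
Proof.
move=> rr; rewrite ffunMnE !ffunE.
have /negbTE -> : r != j by apply: contraNneq rj => <-.
by rewrite subr0; case: eqP => _; rewrite ?mul1n ?mul0n ?mul0rn ?natz.
Qed.

Lemma sub_arcvMn l g r : row r -> (g - arcv i j *+ l) r = g r - ((r == i) * l)%N%:Z.
Proof. by move=> rr; rewrite -(arcvMnE l rr) !ffunE. Qed.

Variable c : {ffun I -> int} -> R.
Hypothesis cL : lorentzian_array c.

Lemma geom_eq0 g r : row r -> g r < 0 -> geom i j z c g = 0.
Proof.
move=> rr gr; apply: big1 => l _; rewrite (array_eq0 cL rr) ?mulr0//.
by rewrite sub_arcvMn//; lia.
Qed.

Lemma geom_widen (N : nat) g : g i <= N%:Z ->
  geom i j z c g = \sum_(l < N.+1) z ^+ l * c (g - arcv i j *+ l).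
Proof.
move=> giN; have [gi|gi] := ltrP (g i) 0.
  rewrite (geom_eq0 ri)// big1// => l _; rewrite (array_eq0 cL ri) ?mulr0//.
  by rewrite sub_arcvMn//; lia.
have le : (`|g i|.+1 <= N.+1)%N by lia.
rewrite /geom (big_ord_widen _ (fun l => z ^+ l * c (g - arcv i j *+ l)) le).
rewrite big_mkcond; apply: eq_bigr => l _; case: ifPn => // h.
rewrite (array_eq0 cL ri) ?mulr0// sub_arcvMn// eqxx mul1n; lia.
Qed.

Lemma geom_rec g : 0 <= g i ->
  geom i j z c g = c g + z * geom i j z c (g - arcv i j).
Proof.
move=> gi; have giE : g i = `|g i|%N by lia.
rewrite (@geom_widen (`|g i|).+1); last by lia.
rewrite big_ord_recl expr0 mul1r mulr0n subr0; congr (_ + _).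
have gi1 : (g - arcv i j) i = g i - 1.
  by have := sub_arcvMn 1 g ri; rewrite eqxx mulr1n.
rewrite (@geom_widen `|g i|%N) ?gi1; last by lia.
rewrite mulr_sumr; apply: eq_bigr => l _.
by rewrite lift0 mulrA -exprS mulrS opprD addrA.
Qed.

(** Induction on [g i], which each step lowers by one. At [g i = 0] the shifted point has coordinate
    -1 at [i], so its Hessian lives on the row and column of [i] and [lorentzian_at_star]
    applies. *)
Lemma lorentzian_array_geom : lorentzian_array (geom i j z c).
Proof.
have pos g : rows_ge0 g -> 0 < geom i j z c g.
  move=> gp; rewrite /geom big_ord_recl ltr_wpDr//.
    by apply: sumr_ge0 => l _; rewrite mulr_ge0 ?array_ge0// exprn_ge0// ltW.
  by rewrite mulr0n subr0 expr0 mul1r (array_gt0 cL).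
have ge0 g : 0 <= geom i j z c g.
  by apply: sumr_ge0 => l _; rewrite mulr_ge0 ?array_ge0// exprn_ge0// ltW.
split => //; first exact: geom_eq0.
have step g : rows_ge0 g -> lorentzian_at (geom i j z c) (g - arcv i j) ->
    lorentzian_at (geom i j z c) g.
  move=> gp; apply: (lorentzian_geometric_step z_gt0 (c := c)) => //.
  - move=> a b; rewrite geom_rec; last first.
      by move/rows_ge0P: (rows_ge0D b (rows_ge0D a gp)); apply.
    by congr (_ + _ * geom _ _ _ _ _); apply/ffunP => t; rewrite !ffunE; ring.
  - by rewrite (array_gt0 cL)// !rows_ge0D.
  - exact: array_ge0.
  - exact: array_lorentzian.
have gE g r : row r -> (g - arcv i j) r = g r - (r == i)%:Z.
  by move=> rr; have := sub_arcvMn 1 g rr; rewrite mulr1n muln1.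
move=> g; move: {-1}`|g i|%N (erefl `|g i|%N) => n.
elim: n g => [|n IH] g gn gp; apply: step => //.
  apply: (lorentzian_at_star (r := i)) => a b ai bi; rewrite (geom_eq0 ri)//.
  rewrite [ltLHS]ffunE [X in X + _]ffunE gE// !ffunE.
  by rewrite eqxx ![i == _]eq_sym (negbTE ai) (negbTE bi); lia.
have gi : 0 <= g i by move/rows_ge0P: gp; apply.
apply: IH; first by rewrite gE// eqxx; lia.
apply/rows_ge0P => r rr; rewrite gE//.
have : 0 <= g r by move/rows_ge0P: gp; apply.
by case: eqP => [->|_]; lia.
Qed.

End Geom.

(** Divided by the value at [g], the Hessian matrix is the rank one matrix [r a * r b] minus the
    diagonal [r a ^+ 2 - q a], which is nonnegative by log-concavity of the factors. *)
Lemma lorentzian_at_prod (f : I -> int -> R) g :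
  (forall a, 0 < f a (g a)) ->
  (forall a, f a (g a) * f a (g a + 1 + 1) <= f a (g a + 1) ^+ 2) ->
  lorentzian_at (fun g => \prod_a f a (g a)) g.
Proof.
move=> f0 flc; set W := fun g => _.
pose r a := f a (g a + 1) / f a (g a).
pose q a := f a (g a + 1 + 1) / f a (g a).
have W0 : 0 < W g by apply: prodr_gt0 => a _.
have f0' a : f a (g a) != 0 by rewrite gt_eqF.
have WD (h : {ffun I -> int}) a : f a (h a) != 0 -> W (h + unitv a) = W h * (f a (h a + 1) / f a (h a)).
  move=> fa; rewrite /W (bigD1 a)//= [in RHS](bigD1 a)//= !ffunE eqxx.
  under eq_bigr => b ba do rewrite !ffunE (negbTE ba) addr0.
  by field.
have WE a b : a != b -> W (g + unitv a + unitv b) = W g * (r a * r b).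
  move=> ab.
  have gb : (g + unitv a) b = g b by rewrite !ffunE [b == a]eq_sym (negbTE ab) addr0.
  rewrite WD gb//.
  by rewrite WD// /r; field; rewrite !f0'.
have WEE a : W (g + unitv a + unitv a) = W g * q a.
  rewrite /W (bigD1 a)//= [in RHS](bigD1 a)//= !ffunE eqxx.
  under eq_bigr => b ba do rewrite !ffunE (negbTE ba) !addr0.
  by rewrite /q; field.
exists r => v v0.
have -> : hess W g v v =
    W g * ((\sum_a r a * v a) ^+ 2 - \sum_a (r a ^+ 2 - q a) * v a ^+ 2).
  rewrite expr2 mulr_suml -sumrB mulr_sumr; apply: eq_bigr => a _.
  rewrite mulr_sumr (bigD1 a)//= WEE [in RHS](bigD1 a)//=.
  under eq_bigr => b ba do rewrite WE 1?eq_sym//.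
  rewrite addrAC mulrDr mulr_sumr; congr (_ + _); first by ring.
  by apply: eq_bigr => b _; ring.
rewrite v0 expr0n sub0r pmulr_rle0// oppr_le0 sumr_ge0// => a _.
rewrite mulr_ge0 ?sqr_ge0// subr_ge0 /r /q.
rewrite exprMn exprVn ler_pdivlMr ?exprn_gt0//.
by rewrite (le_trans _ (flc a))// [leLHS](_ : _ = f a (g a) * f a (g a + 1 + 1))//; field.
Qed.

(* A strictly positive regularization of the point mass at 0, which is its     *)
(* value at [e = 0]: positivity avoids the degenerate case of the step above.  *)
Definition seed (e : R) g : R :=
  \prod_a (if row a && (g a < 0) then 0 else e ^+ `|g a|%N).

(** The absolute value is convex on the integers and linear on the nonnegative ones, so for [e <= 1]
    each factor is log-concave. *)
Lemma lorentzian_array_seed e : 0 < e <= 1 -> lorentzian_array (seed e).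
Proof.
move=> /andP[e0 e1]; split.
- move=> g /rows_ge0P gp; apply: prodr_gt0 => a _; case: ifPn => [/andP[ra]|_].
    by rewrite ltNge gp.
  exact: exprn_gt0.
- by move=> g r rr gr; rewrite /seed (bigD1 r)//= rr gr mul0r.
move=> g /rows_ge0P gp.
pose f a k := if row a && (k < 0) then 0 else e ^+ `|k|%N.
apply: (@lorentzian_at_prod f) => a; rewrite /f.
  case: ifPn => [/andP[ra]|_]; last exact: exprn_gt0.
  by rewrite ltNge gp.
have [ra|ra] /= := boolP (row a).
  have g0 := gp _ ra.
  by rewrite !ltNge g0 !addr_ge0//= -exprD -exprM ler_wiXn2l ?(ltW e0)//; lia.
by rewrite -exprD -exprM ler_wiXn2l ?(ltW e0)//; lia.
Qed.

End Arrays.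

(** * Log-concavity of weighted table counts *)

(** By continuity at 0. It serves to remove the regularization [e] of the seed from an inequality
    that is polynomial in [e]. *)
Lemma horner_ge0_at0 (R : realType) (p : {poly R}) :
  (forall e : R, 0 < e <= 1 -> 0 <= p.[e]) -> 0 <= p.[0].
Proof.
move=> p_ge0; rewrite leNgt; apply/negP => p0.
have /cvgrPdist_lt /(_ (- p.[0])) : (horner p x @[x --> (0 : R)] --> p.[0])%classic.
  exact: continuous_horner.
rewrite oppr_gt0 => /(_ p0) /nbhs_ballP[d /= d0 hd].
pose e := Num.min (d / 2) 1.
have e0 : 0 < e by rewrite lt_min ltr01 divr_gt0.
have ed : e < d by rewrite gt_min ltr_pdivrMr ?ltr_pMr ?ltr1n.

have := hd e; rewrite /ball /= sub0r normrN gtr0_norm// => /(_ ed).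
have := p_ge0 e; rewrite e0 ge_min lexx orbT => /(_ isT) pe.
by rewrite ltr_norml; lra.
Qed.

Section Tables.
Variables (R : realType) (I C : finType) (row : pred I) (src tgt : C -> I).
Variables (z : C -> R) (N : nat).
Hypotheses (src_row : forall o, row (src o)) (tgt_row : forall o, ~~ row (tgt o)).
Hypothesis z_gt0 : forall o, 0 < z o.
Implicit Types (A : {ffun C -> 'I_N.+1}) (g : {ffun I -> int}).

(** Each unit in cell [o] is a unit of flow from [src o] to [tgt o]: row sums appear on the row
    labels, negated column sums on the others. *)
Definition margin A : {ffun I -> int} := \sum_o arcv (src o) (tgt o) *+ A o.

Definition table_weight A : R := \prod_o z o ^+ A o.

Definition geoms (c : {ffun I -> int} -> R) (s : seq C) :=
  foldr (fun o => geom (src o) (tgt o) (z o)) c s.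

Lemma lorentzian_array_geoms c s :
  lorentzian_array row c -> lorentzian_array row (geoms c s).
Proof. by move=> cL; elim: s => //= o s IH; exact: lorentzian_array_geom. Qed.

Definition supported (s : seq C) A := [forall o, (o \in s) || (A o == ord0)].

Definition upd A o (l : 'I_N.+1) : {ffun C -> 'I_N.+1} :=
  [ffun o' => if o' == o then l else A o'].

(** The geometric series are expanded cell by cell. The bound by [N] makes the truncation of entries
    harmless, and it survives the induction because row coordinates only decrease. *)
Lemma geomsE c s g : lorentzian_array row c -> uniq s ->
  (forall r, row r -> g r <= N%:Z) ->
  geoms c s g = \sum_(A | supported s A) table_weight A * c (g - margin A).
Proof.
move=> cL; elim: s g => [|o s IH] g /=.
  move=> _ _; rewrite (big_pred1 [ffun=> ord0]) => [|A].
    rewrite /table_weight big1 => [|o _]; last by rewrite ffunE.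
    by rewrite mul1r /margin big1 ?subr0// => o _; rewrite ffunE.
  apply/forallP/eqP => [h|-> o]; last by rewrite ffunE eqxx orbT.
  by apply/ffunP => o; rewrite ffunE; apply/eqP; have := h o.
move=> /andP[os us] gN.
rewrite (geom_widen (src_row o) (tgt_row o) (z_gt0 o) (lorentzian_array_geoms s cL) (gN _ (src_row o))).
rewrite [RHS](partition_big (fun A => A o) predT)//=; apply: eq_bigr => l _.
rewrite IH//; last first.
  move=> r rr; rewrite (sub_arcvMn _ (tgt_row o))//.
  by have := gN r rr; lia.
(* The fibre over [l] is parametrized by the tables vanishing at [o], into which [upd] writes
   [l]. *)
rewrite mulr_sumr [RHS](reindex_onto (fun A => upd A o l) (fun A => upd A o ord0)); last first.
  move=> A /andP[_ /eqP Ao]; apply/ffunP => o'; rewrite !ffunE.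
  by case: eqP => [->|//]; rewrite Ao.
apply: eq_big => [A|A sA].
  apply/idP/idP.
    move=> /forallP h; have Ao : A o = ord0 by have := h o; rewrite (negbTE os) => /eqP.
    rewrite -andbA; apply/and3P; split.
    - apply/forallP => o'; rewrite inE ffunE; case: eqP => //= _; exact: h.
    - by rewrite ffunE eqxx.
    - by apply/eqP/ffunP => o'; rewrite !ffunE; case: eqP => [->|].
  move=> /andP[/andP[/forallP h _] /eqP E]; apply/forallP => o'.
  have := h o'; rewrite inE ffunE; have [->|//] := eqVneq o' o.
  by move=> _; rewrite -E !ffunE eqxx orbT.
have Ao : A o = ord0 by move/forallP/(_ o): sA; rewrite (negbTE os) => /eqP.
rewrite mulrA; congr (_ * c _).
  rewrite /table_weight [in RHS](bigD1 o)//= [in LHS](bigD1 o)//= Ao expr0 mul1r.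
  rewrite ffunE eqxx; congr (_ * _); apply: eq_bigr => o' /negbTE oo.
  by rewrite ffunE oo.
rewrite -addrA -opprD; congr (_ - _).
rewrite /margin [in RHS](bigD1 o)//= [in LHS](bigD1 o)//= Ao mulr0n add0r.
rewrite ffunE eqxx; congr (_ + _); apply: eq_bigr => o' /negbTE oo.
by rewrite ffunE oo.
Qed.

Definition table_sum g : R := \sum_(A | margin A == g) table_weight A.

(** The seed as a polynomial in its parameter. For [g] bounded by [N] on rows, [tabp g] is a
    Lorentzian array at each [0 < e <= 1]; at 0 it is the weighted table count. *)
Let seedp g : {poly R} :=
  \prod_a (if row a && (g a < 0) then 0 else 'X^`|g a|%N).

Let tabp g : {poly R} := \sum_A (table_weight A)%:P * seedp (g - margin A).

Let seedpE e g : (seedp g).[e] = seed row e g.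
Proof.
rewrite horner_prod; apply: eq_bigr => a _.
by case: ifP => _; rewrite ?horner0 ?hornerXn.
Qed.

Let tabp_horner e g : 0 < e <= 1 -> (forall r, row r -> g r <= N%:Z) ->
  (tabp g).[e] = geoms (seed row e) (enum C) g.
Proof.
move=> e01 gN; rewrite geomsE ?enum_uniq//; last exact: lorentzian_array_seed.
rewrite horner_sum; apply: eq_big => [A|A _].
  by symmetry; apply/forallP => o; rewrite mem_enum.
by rewrite hornerM hornerC seedpE.
Qed.

(** At 0 a power of the variable survives only if its exponent is 0, so only the tables with margin
    exactly [g] remain. *)
Let tabp0 g : (tabp g).[0] = table_sum g.
Proof.
rewrite horner_sum /table_sum [RHS]big_mkcond; apply: eq_bigr => A _ /=.
rewrite hornerM hornerC seedpE /seed; case: eqP => [<-|/eqP ne].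
  rewrite subrr big1 ?mulr1// => a _.
  by rewrite ffunE ltxx andbF absz0 expr0.
have [a ga] : exists a, (g - margin A) a != 0.
  apply/existsP; apply: contraNT ne => /existsPn h.
  rewrite eq_sym -subr_eq0; apply/eqP/ffunP => a; apply/eqP.
  by rewrite [X in _ == X]ffunE; have := h a; rewrite negbK.
rewrite (bigD1 a)//=; case: ifP => _; first by rewrite mul0r mulr0.
by rewrite expr0n absz_eq0 (negbTE ga) mul0r mulr0.
Qed.

(** Log-concavity of the Lorentzian arrays for [e > 0] passes to the limit. Two unit vectors raise a
    row coordinate by at most 2, hence the bound on [g]. *)
Theorem table_sum_log_concave g a b : rows_ge0 row g ->
  (forall r, row r -> g r + 2%:Z <= N%:Z) ->
  table_sum (g + unitv a + unitv a) * table_sum (g + unitv b + unitv b) <=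
  table_sum (g + unitv a + unitv b) ^+ 2.
Proof.
move=> gp gN.
have le2 (x y : I) r : row r -> (g + unitv x + unitv y) r <= N%:Z.
  by move=> /gN; rewrite !ffunE; case: (r == x); case: (r == y); rewrite ?mulr1n ?mulr0n; lra.
pose p := tabp (g + unitv a + unitv b) ^+ 2 -
  tabp (g + unitv a + unitv a) * tabp (g + unitv b + unitv b).
have : 0 <= p.[0].
  apply: horner_ge0_at0 => e e01; rewrite !hornerE !tabp_horner ?subr_ge0//;
    try (by move=> r rr; exact: le2).
  have L := lorentzian_array_geoms (enum C) (lorentzian_array_seed row e01).
  apply: lorentzian_log_concave; first exact: (array_lorentzian L).
  exact: array_ge0 L.
by rewrite !hornerE !tabp0 subr_ge0.
Qed.

End Tables.

(** * Capacity of log-concave sequences *)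

Lemma sum_geometric_le (R : realFieldType) (q : R) n : 0 <= q < 1 ->
  \sum_(l < n) q ^+ l <= (1 - q)^-1.
Proof.
move=> /andP[q0 q1]; have q1' : 0 < 1 - q by rewrite subr_gt0.
rewrite -[leRHS]mul1r ler_pdivlMr// mulrC.
have -> : (1 - q) * \sum_(l < n) q ^+ l = 1 - q ^+ n.
  by rewrite -opprB mulNr -subrX1 opprB.
by rewrite gerBl exprn_ge0.
Qed.

(** From [1 + u <= expR u] at the inverse of [k + 1], raised to the power [k + 1]. *)
Lemma expn_succ_le_expR (R : realType) k :
  k.+2%:R ^+ k.+1 <= expR 1 * k.+1%:R ^+ k.+1 :> R.
Proof.
rewrite -ler_pdivrMr ?exprn_gt0// -expr_div_n.
have -> : k.+2%:R / k.+1%:R = 1 + k.+1%:R^-1 :> R.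
  by rewrite -natr1 mulrDl divff// mul1r.
apply: (@le_trans _ _ (expR k.+1%:R^-1 ^+ k.+1)).
  by rewrite lerXn2r// ?nnegrE ?expR_ge0 ?addr_ge0// expR_ge1Dx.
by rewrite -expRM_natl divff.
Qed.

Lemma expR1_ge2 (R : realType) : 2 <= expR 1 :> R.
Proof. by have := expR_ge1Dx (1 : R); rewrite -(natrD _ 1 1). Qed.

(* For k > 0, q = k / (k + 1) minimizes q^-k / (1 - q). *)
Lemma geometric_weight (R : realType) k : exists2 q : R, 0 < q < 1 &
  (1 - q)^-1 <= expR 1 * k.+1%:R * q ^+ k.
Proof.
case: k => [|k].
  (* For [k = 0] any positive [q] up to [1 - 1 / e] works; one half uses [2 <= e]. *)
  exists 2^-1; first by apply/andP; split; lra.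
  have -> : (1 - 2^-1)^-1 = 2 :> R by field.
  by rewrite expr0 !mulr1 expR1_ge2.
have k2 : 0 < k.+2%:R :> R by [].
exists (k.+1%:R / k.+2%:R).
  by rewrite divr_gt0//= ltr_pdivrMr// mul1r ltr_nat.
have -> : 1 - k.+1%:R / k.+2%:R = k.+2%:R^-1 :> R.
  by rewrite -[in X in X - _](@divff _ k.+2%:R)// -mulrBl -natrB// subSnn mul1r.
rewrite invrK mulrAC ler_pMl// expr_div_n mulrA ler_pdivlMr ?exprn_gt0// mul1r.
exact: expn_succ_le_expR.
Qed.

Section LogConcave.
Variables (R : realType) (a : nat -> R) (M k : nat).
Hypotheses (kM : (k <= M)%N) (a_gt0 : forall l, (l <= M)%N -> 0 < a l).
Hypothesis a_lc : forall l, (l.+2 <= M)%N -> a l * a l.+2 <= a l.+1 ^+ 2.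

(** Log-concavity makes the ratios of consecutive terms decrease, so for [k > 0] the ratio entering
    [a k] is the slope of a tangent to the logarithm of the sequence at [k]. *)
Lemma log_concave_tangent :
  exists2 r : R, 0 < r & forall l, (l <= M)%N -> a l * r ^+ k <= a k * r ^+ l.
Proof.
case: k kM => [|k' kM'].
  (* No ratio enters index 0, so [r] is chosen large enough that [a 0 * r] exceeds every term. *)
  move=> _; pose r := 1 + (\sum_(l < M.+1) a l) / a 0%N.
  have a0 := a_gt0 (leq0n M).
  have S0 : 0 <= \sum_(l < M.+1) a l.
    by apply: sumr_ge0 => l _; rewrite ltW// a_gt0// -ltnS.
  have r1 : 1 <= r by rewrite /r lerDl divr_ge0// ltW.
  exists r => [|[|l] lM]; [by rewrite (lt_le_trans _ r1)|by []|].
  rewrite expr0 mulr1.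
  apply: (@le_trans _ _ (a 0%N * r)); last first.
    by rewrite ler_pM2l// exprS ler_peMr ?(le_trans ler01)// exprn_ege1.
  rewrite /r mulrDr mulr1 mulrC divfK ?gt_eqF//.
  rewrite (bigD1 (inord l.+1))//= inordK// addrCA lerDl addr_ge0// ?(ltW a0)//.
  by apply: sumr_ge0 => i _; rewrite ltW// a_gt0// -ltnS.
pose rho l := a l.+1 / a l.
have rho_dec i d : (i + d < M)%N -> rho (i + d)%N <= rho i.
  elim: d => [|d IH] idM; first by rewrite addn0.
  apply: le_trans (IH _); last by lia.
  rewrite /rho addnS ler_pdivrMr; last by rewrite a_gt0//; lia.
  rewrite mulrAC ler_pdivlMr; last by rewrite a_gt0//; lia.
  by rewrite mulrC -expr2 a_lc//; lia.
have aS l : (l < M)%N -> a l.+1 = a l * rho l.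
  by move=> lM; rewrite /rho mulrC divfK// gt_eqF// a_gt0// ltnW.
have r0 : 0 < rho k' by rewrite divr_gt0// a_gt0// ltnW.
have fwd d : (k'.+1 + d <= M)%N -> a (k'.+1 + d)%N <= a k'.+1 * rho k' ^+ d.
  elim: d => [|d IH] dM; first by rewrite addn0 mulr1.
  rewrite addnS aS; last by lia.
  rewrite exprSr mulrA ler_pM ?IH//; try lia.
  - by rewrite ltW// a_gt0//; lia.
  - by rewrite divr_ge0// ltW// a_gt0//; lia.
  - by rewrite addSnnS rho_dec//; lia.
have bwd d : (d <= k'.+1)%N -> a (k'.+1 - d)%N * rho k' ^+ d <= a k'.+1.
  elim: d => [|d IH] dk; first by rewrite subn0 mulr1.
  apply: le_trans (IH _); last by lia.
  rewrite exprS mulrA ler_pM2r ?exprn_gt0//.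
  have -> : (k'.+1 - d = (k'.+1 - d.+1).+1)%N by lia.
  rewrite aS; last by lia.
  rewrite ler_pM2l; last by rewrite a_gt0//; lia.
  by have := @rho_dec (k'.+1 - d.+1)%N d; rewrite subSS subnK//; apply; lia.
exists (rho k') => // l lM.
have [kl|lk] := leqP k'.+1 l.
  rewrite -{1 2}(subnKC kl) exprD mulrCA mulrC ler_pM2l ?exprn_gt0//.
  by rewrite fwd// subnKC.
rewrite -{1}(subnK (ltnW lk)) exprD mulrA ler_pM2r ?exprn_gt0//.
by have := bwd (k'.+1 - l)%N; rewrite subKn ?leq_subr 1?ltnW//; exact.
Qed.

(** With [t = q / r] the tangent bounds [a l * t ^+ l] by [a k / r ^+ k * q ^+ l]; the geometric
    series in [q] then gives a constant independent of [M]. *)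
Lemma log_concave_capacity : exists2 t : R, 0 < t &
  \sum_(l < M.+1) a l * t ^+ l <= expR 1 * k.+1%:R * (a k * t ^+ k).
Proof.
have [r r0 ar] := log_concave_tangent.
have [q /andP[q0 q1] qk] := geometric_weight R k.
exists (q / r); first exact: divr_gt0.
apply: (@le_trans _ _ (a k / r ^+ k * (1 - q)^-1)).
  apply: (@le_trans _ _ (\sum_(l < M.+1) a k / r ^+ k * q ^+ l)); last first.
    rewrite -mulr_sumr ler_wpM2l// ?divr_ge0 ?exprn_ge0 ?(ltW r0) ?(ltW (a_gt0 _))//.
    by rewrite sum_geometric_le// ltW.
  apply: ler_sum => l _; rewrite expr_div_n mulrCA mulrC ler_wpM2r ?exprn_ge0 ?(ltW q0)//.
  rewrite ler_pdivlMr ?exprn_gt0// mulrAC ler_pdivrMr ?exprn_gt0//.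
  by rewrite ar// -ltnS.
apply: (@le_trans _ _ (a k / r ^+ k * (expR 1 * k.+1%:R * q ^+ k))).
  by rewrite ler_wpM2l// divr_ge0 ?exprn_ge0 ?(ltW r0) ?(ltW (a_gt0 _)).
by rewrite expr_div_n le_eqVlt; apply/orP; left; apply/eqP; ring.
Qed.

End LogConcave.

(** * Extraction of columns *)

Lemma prod_sum_trunc (R : comPzSemiRingType) (T : finType) (N : nat) (K : T -> nat)
    (F : T -> nat -> R) : (forall t, (K t <= N)%N) ->
  \prod_t \sum_(l < (K t).+1) F t l =
  \sum_(v : {ffun T -> 'I_N.+1} | [forall t, (v t <= K t)%N]) \prod_t F t (v t).
Proof.
move=> KN.
transitivity (\prod_t \sum_(l < N.+1 | (l <= K t)%N) F t l).
  by apply: eq_bigr => t _; rewrite (big_ord_widen N.+1 (F t)) ?ltnS.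
rewrite (bigA_distr_big_dep (fun t (l : 'I_N.+1) => (l <= K t)%N) (fun t (l : 'I_N.+1) => F t l)).
by apply: eq_bigl => v; apply/familyP/forallP.
Qed.

Section CompleteSymmetric.
Variables (R : realType) (m N : nat) (x : 'I_m.+1 -> R).
Hypothesis x_gt0 : forall i, 0 < x i.
Implicit Type v : {ffun 'I_m.+1 -> 'I_N.+1}.

(* The exponents are truncated at [N], so this is the complete homogeneous     *)
(* symmetric polynomial only for [l <= N].                                     *)
Definition hsym l : R :=
  \sum_(v : {ffun 'I_m.+1 -> 'I_N.+1} | (\sum_i v i)%N == l) \prod_i x i ^+ v i.

Lemma prodX_gt0 v : 0 < \prod_i x i ^+ v i.
Proof. by apply: prodr_gt0 => i _; exact: exprn_gt0. Qed.

Lemma hsym_gt0 l : (l <= N)%N -> 0 < hsym l.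
Proof.
move=> lN; pose v : {ffun 'I_m.+1 -> 'I_N.+1} := [ffun i => if i == ord0 then inord l else ord0].
rewrite /hsym (bigD1 v)/=.
  by rewrite ltr_pwDl ?prodX_gt0// sumr_ge0// => w _; exact/ltW/prodX_gt0.
rewrite (bigD1 ord0)//= big1 => [|i i0]; last by rewrite ffunE (negbTE i0).
by rewrite addn0 ffunE eqxx inordK.
Qed.

(** A single column whose cells all share one row label: each cell is an arc from [true] to [false],
    and [hsym k] counts the tables of margin [k] times that arc. Two units at [true] or at [false],
    or one at each, reach three consecutive degrees. *)
Lemma hsym_log_concave l : (l.+2 <= N)%N -> hsym l * hsym l.+2 <= hsym l.+1 ^+ 2.
Proof.
move=> lN.
have hE k : hsym k = table_sum (I := bool) (fun=> true) (fun=> false) x N (arcv true false *+ k).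
  apply: eq_bigl => v; rewrite /margin sumrMnr.
  apply/eqP/eqP => [->//|/ffunP/(_ true)]; rewrite !ffunMnE !ffunE /= subr0.
  by rewrite !natz => -[].
have E k (u w : {ffun bool -> int}) : arcv true false *+ k - unitv false - unitv false + u + w =
    arcv true false *+ k + (u - unitv false) + (w - unitv false).
  by apply/ffunP => t; rewrite !ffunE; ring.
have := @table_sum_log_concave R bool 'I_m.+1 id (fun=> true) (fun=> false) x N
  (fun=> isT) (fun=> isT) x_gt0 (arcv true false *+ l - unitv false - unitv false) true false.
rewrite !E !subrr !addr0 -/(arcv true false) -!mulrSr -!hE mulrC; apply.
  by apply/rows_ge0P => -[] // _; rewrite !ffunE ffunMnE !ffunE /= !subr0 natz.
by case=> // _; rewrite !ffunE ffunMnE !ffunE /= !subr0 natz; lia.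
Qed.

Lemma prod_sum_trunc_le_hsym (K : 'I_m.+1 -> nat) (y : R) :
  (\sum_i K i <= N)%N -> 0 < y ->
  \prod_i \sum_(l < (K i).+1) x i ^+ l * y ^+ l <= \sum_(l < N.+1) hsym l * y ^+ l.
Proof.
move=> KN y0.
have KiN i : (K i <= N)%N by rewrite (leq_trans _ KN)// (bigD1 i)//= leq_addr.
rewrite (prod_sum_trunc (fun i l => x i ^+ l * y ^+ l) KiN).
(* Exponents below [K] have total degree at most [N], so [inord] returns that degree exactly. *)
pose deg v : 'I_N.+1 := inord (\sum_i v i).
rewrite (partition_big deg predT)//=; apply: ler_sum => l _.
rewrite /hsym mulr_suml.
rewrite [leLHS]big_mkcond [leRHS]big_mkcond; apply: ler_sum => v _ /=.
case: ifPn => [/andP[/forallP vK /eqP dv]|_]; last first.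
  by case: ifP => // _; rewrite mulr_ge0 ?exprn_ge0 ?(ltW y0)// ltW// prodX_gt0.
have vl : (\sum_i v i)%N = l.
  rewrite -dv inordK// ltnS (leq_trans _ KN)//; exact: leq_sum.
by rewrite vl eqxx big_split /= -vl -prodrXr.
Qed.

Lemma hsym_capacity (K : 'I_m.+1 -> nat) k : (\sum_i K i <= N)%N -> (k <= N)%N ->
  exists2 y : R, 0 < y &
  \prod_i \sum_(l < (K i).+1) x i ^+ l * y ^+ l <=
  expR 1 * k.+1%:R * (hsym k * y ^+ k).
Proof.
move=> KN kN; have [y y0 h] := log_concave_capacity kN hsym_gt0 hsym_log_concave.
by exists y => //; apply: le_trans h; exact: prod_sum_trunc_le_hsym.
Qed.

(* When the other rows cannot fill a column of sum [k], its dominant entry is *)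
(* nearly forced, so one evaluates at a point [y > 1] close to 1.              *)
Lemma hsym_capacity_large (K : 'I_m.+1 -> nat) k (A : nat) :
  x ord0 = 1 -> (K ord0 <= k)%N -> (\sum_(i | i != ord0) K i <= A)%N ->
  (A <= k <= N)%N ->
  exists2 y : R, 0 < y &
  \prod_i \sum_(l < (K i).+1) x i ^+ l * y ^+ l <=
  expR 1 * A.+1%:R * (hsym k * y ^+ k).
Proof.
move=> x0 K0 KA /andP[Ak kN].
(* [y] is the inverse of the geometric weight at [A]: the power [y ^+ A] pays for the other rows,
   the geometric series in [1 / y] for row [ord0]. *)
have [y y1 yA] : exists2 y : R, 1 < y & y ^+ A * (1 - y^-1)^-1 <= expR 1 * A.+1%:R.
  have [q /andP[q0 q1] h] := geometric_weight R A.
  exists q^-1; first by rewrite invf_gt1.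
  by rewrite invrK exprVn mulrC ler_pdivrMr ?exprn_gt0.
have y0 : 0 < y by rewrite (lt_trans ltr01).
exists y => //; rewrite (bigD1 ord0)//= x0.
have h0 : \sum_(l < (K ord0).+1) 1 ^+ l * y ^+ l <= y ^+ k * (1 - y^-1)^-1.
  apply: (@le_trans _ _ (\sum_(l < k.+1) y ^+ l)).
    rewrite (big_ord_widen k.+1 (fun l => 1 ^+ l * y ^+ l)) ?ltnS//.
    rewrite big_mkcond; apply: ler_sum => l _; rewrite expr1n mul1r.
    by case: ifP => // _; rewrite exprn_ge0// ltW.
  rewrite (reindex_inj rev_ord_inj)/=.
  have -> : \sum_(l < k.+1) y ^+ (k.+1 - l.+1) = y ^+ k * \sum_(l < k.+1) y^-1 ^+ l.
    rewrite mulr_sumr; apply: eq_bigr => l _; rewrite subSS exprVn.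
    by rewrite expfB_cond ?(gt_eqF y0)// add0n -ltnS.
  rewrite ler_pM2l ?exprn_gt0// sum_geometric_le// invr_ge0 (ltW y0)/=.
  by rewrite invf_lt1.
have h1 : \prod_(i | i != ord0) \sum_(l < (K i).+1) x i ^+ l * y ^+ l <=
    y ^+ A * \prod_(i | i != ord0) \sum_(l < (K i).+1) x i ^+ l.
  apply: (@le_trans _ _ (\prod_(i | i != ord0) (y ^+ K i * \sum_(l < (K i).+1) x i ^+ l))).
    apply: ler_prod => i _; apply/andP; split.
      by apply: sumr_ge0 => l _; rewrite mulr_ge0// exprn_ge0// ltW.
    rewrite mulr_sumr; apply: ler_sum => l _; rewrite mulrC ler_pM2r ?exprn_gt0//.
    by rewrite ler_weXn2l ?(ltW y1)// -ltnS.
  rewrite big_split /= prodrXr ler_wpM2r//.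
    by apply: prodr_ge0 => i _; apply: sumr_ge0 => l _; rewrite exprn_ge0// ltW.
  by rewrite ler_weXn2l ?(ltW y1).
(* With [y] removed, the exponents in the other rows total at most [A <= k]; row [ord0], of weight
   1, completes them to degree [k]. *)
have h2 : \prod_(i | i != ord0) \sum_(l < (K i).+1) x i ^+ l <= hsym k.
  pose K' i := if i == ord0 then 0%N else K i.
  have K'N i : (K' i <= N)%N.
    rewrite /K'; case: eqP => // /eqP i0; apply: leq_trans kN; apply: leq_trans Ak.
    by apply: leq_trans KA; rewrite (bigD1 i)//= leq_addr.
  have -> : \prod_(i | i != ord0) \sum_(l < (K i).+1) x i ^+ l =
      \prod_i \sum_(l < (K' i).+1) x i ^+ l.
    rewrite [RHS](bigD1 ord0)//= big_ord_recl big_ord0 addr0 expr0 mul1r.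
    by apply: eq_bigr => i i0; rewrite /K' (negbTE i0).
  rewrite (prod_sum_trunc (fun i l => x i ^+ l) K'N).
  pose del v : {ffun 'I_m.+1 -> 'I_N.+1} := [ffun i => if i == ord0 then ord0 else v i].
  rewrite /hsym [leRHS](partition_big del predT)//=.
  rewrite [leLHS]big_mkcond; apply: ler_sum => v _; case: ifPn => [/forallP vK|_]; last first.
    by apply: sumr_ge0 => w _; exact/ltW/prodX_gt0.
  have v0 : v ord0 = ord0.
    by apply: val_inj; have := vK ord0; rewrite /K' eqxx leqn0 => /eqP.
  have sv : (\sum_(i | i != ord0) v i <= k)%N.
    apply: leq_trans Ak; apply: leq_trans KA; apply: leq_sum => i i0.
    by have := vK i; rewrite /K' (negbTE i0).
  pose d := (k - \sum_(i | i != ord0) v i)%N.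
  pose w : {ffun 'I_m.+1 -> 'I_N.+1} := [ffun i => if i == ord0 then inord d else v i].
  have dN : (d < N.+1)%N by rewrite ltnS (leq_trans _ kN)// leq_subr.
  have wv : \prod_i x i ^+ w i = \prod_i x i ^+ v i.
    rewrite (bigD1 ord0)//= [RHS](bigD1 ord0)//= x0 !expr1n; congr (_ * _).
    by apply: eq_bigr => i i0; rewrite ffunE (negbTE i0).
  rewrite (bigD1 w)/=; last first.
    apply/andP; split.
      rewrite (bigD1 ord0)//= ffunE eqxx inordK//.
      under eq_bigr => i i0 do rewrite ffunE (negbTE i0).
      by rewrite subnK.
    by apply/eqP/ffunP => i; rewrite !ffunE; case: eqP => [->|].
  by rewrite wv lerDl; apply: sumr_ge0 => u _; exact/ltW/prodX_gt0.
have hs0 := hsym_gt0 kN.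
have P0 : 0 <= \prod_(i | i != ord0) \sum_(l < (K i).+1) x i ^+ l * y ^+ l.
  by apply: prodr_ge0 => i _; apply: sumr_ge0 => l _; rewrite mulr_ge0// exprn_ge0// ltW.
have iy : 0 < 1 - y^-1 by rewrite subr_gt0 invf_lt1.
apply: (@le_trans _ _ ((y ^+ k * (1 - y^-1)^-1) * (y ^+ A * hsym k))).
  apply: ler_pM => //.
    by apply: sumr_ge0 => l _; rewrite mulr_ge0// exprn_ge0// ltW.
  by apply: le_trans h1 _; rewrite ler_pM2l// exprn_gt0.
rewrite (_ : _ * _ = (y ^+ A * (1 - y^-1)^-1) * (hsym k * y ^+ k)); last by ring.
by rewrite ler_pM2r// mulr_gt0// exprn_gt0.
Qed.

End CompleteSymmetric.

(** * Extraction of rows *)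

(** Induction on the total: one unit goes to a cell whose row and column both have positive sum. *)
Lemma contingency_table_exists (S T : finType) (a : S -> nat) (b : T -> nat) :
  (\sum_i a i)%N = (\sum_j b j)%N ->
  exists A : S -> T -> nat, (forall i, (\sum_j A i j)%N = a i) /\
    (forall j, (\sum_i A i j)%N = b j).
Proof.
move sE : (\sum_i a i)%N => s; elim: s a b sE => [|s IH] a b sa sb.
  exists (fun _ _ => 0%N); split => [i|j]; rewrite big1//.
    by move/eqP: sa; rewrite sum_nat_eq0 => /forallP/(_ i)/eqP.
  by move/esym/eqP: sb; rewrite sum_nat_eq0 => /forallP/(_ j)/eqP.
have pos (U : finType) (f : U -> nat) : (\sum_i f i)%N = s.+1 -> exists i, (0 < f i)%N.
  move=> sf; apply/existsP; apply: contra_eqT sf => /existsPn h.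
  by rewrite big1// => i _; apply/eqP; rewrite eqn0Ngt h.
have [i0 ai0] := pos _ _ sa; have [j0 bj0] := pos _ _ (esym sb).
pose dec (U : finType) (u0 : U) (f : U -> nat) u := (f u - (u == u0))%N.
have decE (U : finType) (u0 : U) f : (0 < f u0)%N -> (\sum_u f u)%N = (\sum_u dec U u0 f u).+1.
  move=> f0; rewrite -addn1.
  have -> : 1%N = (\sum_(u : U) (u == u0))%N.
    by rewrite (bigD1 u0)//= eqxx big1// => u /negbTE ->.
  rewrite -big_split; apply: eq_bigr => u _; rewrite /= /dec subnK//.
  by case: eqP => // ->.
have [A [rA cA]] : exists A : S -> T -> nat,
    (forall i, (\sum_j A i j)%N = dec _ i0 a i) /\
    (forall j, (\sum_i A i j)%N = dec _ j0 b j).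
  apply: IH; first by have := decE _ i0 a ai0; lia.
  by have := decE _ j0 b bj0; lia.
exists (fun i j => A i j + (i == i0) * (j == j0))%N; split => [i|j].
  rewrite big_split /= rA -big_distrr /= (bigD1 j0)//= eqxx big1 ?addn0 ?muln1.
    by rewrite /dec subnK//; case: eqP => // ->.
  by move=> j /negbTE ->.
rewrite big_split /= cA -big_distrl /= (bigD1 i0)//= eqxx big1 ?addn0 ?mul1n.
  by rewrite /dec subnK//; case: eqP => // ->.
by move=> i /negbTE ->.
Qed.

(* Rows and columns of a table are bounded by [S]; the margin of 2 in the box  *)
(* size [N] leaves room for the second differences in log-concavity.           *)
Section RowExtraction.
Variables (R : realType) (m n : nat) (alpha : 'I_m.+1 -> nat) (beta : 'I_n -> nat).
Let S := (\sum_j beta j)%N.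
Let N := S.+2.
Local Notation cell := ('I_m.+1 * 'I_n)%type.
Implicit Types (A : {ffun cell -> 'I_N.+1}) (x : 'I_m.+1 -> R).

Definition rowsum (N : nat) (A : {ffun 'I_m.+1 * 'I_n -> 'I_N.+1}) i :=
  (\sum_j A (i, j))%N.
Definition colsum (N : nat) (A : {ffun 'I_m.+1 * 'I_n -> 'I_N.+1}) j :=
  (\sum_i A (i, j))%N.

Definition cols_ok (A : {ffun 'I_m.+1 * 'I_n -> 'I_N.+1}) :=
  [forall j, colsum A j == beta j].
Definition rows_ok (s : nat) (A : {ffun 'I_m.+1 * 'I_n -> 'I_N.+1}) :=
  [forall i : 'I_m.+1, (s <= i)%N ==> (rowsum A i == alpha i)].

Definition row_monomial x (A : {ffun 'I_m.+1 * 'I_n -> 'I_N.+1}) : R :=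
  \prod_o x o.1 ^+ A o.

(** Interpolates between the product of the [hsym] at [s = m.+1] and, at [s = 1] and [x = 1], the
    number of contingency tables. *)
Definition partial_gf s x : R := \sum_(A | cols_ok A && rows_ok s A) row_monomial x A.

Lemma sum_rowsum A : cols_ok A -> (\sum_i rowsum A i)%N = S.
Proof.
by move=> /forallP h; rewrite exchange_big; apply: eq_bigr => j _; exact/eqP/h.
Qed.

Lemma row_monomial_pair x A : row_monomial x A = \prod_i \prod_j x i ^+ A (i, j).
Proof. by rewrite pair_bigA; apply: eq_bigr => -[]. Qed.

Lemma row_monomialE x A : row_monomial x A = \prod_i x i ^+ rowsum A i.
Proof. by rewrite row_monomial_pair; apply: eq_bigr => i _; rewrite prodrXr. Qed.

(** Without row constraints the columns are independent, so the sum over tables factors. *)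
Lemma partial_gf_full x : partial_gf m.+1 x = \prod_j hsym N x (beta j).
Proof.
rewrite /hsym (bigA_distr_big_dep
  (fun j (v : {ffun 'I_m.+1 -> 'I_N.+1}) => (\sum_i v i)%N == beta j)
  (fun j (v : {ffun 'I_m.+1 -> 'I_N.+1}) => \prod_i x i ^+ v i)).
pose tr (f : {ffun 'I_n -> {ffun 'I_m.+1 -> 'I_N.+1}}) : {ffun cell -> 'I_N.+1} :=
  [ffun o => f o.2 o.1].
pose rt A : {ffun 'I_n -> {ffun 'I_m.+1 -> 'I_N.+1}} :=
  [ffun j => [ffun i => A (i, j)]].
rewrite /partial_gf (reindex_onto tr rt)/=; last first.
  by move=> A _; apply/ffunP => -[i j]; rewrite !ffunE.
apply: eq_big => [f|f _].
  have -> : rt (tr f) == f.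
    by apply/eqP/ffunP => j; apply/ffunP => i; rewrite !ffunE.
  have -> : rows_ok m.+1 (tr f) by apply/forallP => i; rewrite leqNgt ltn_ord.
  rewrite !andbT; apply/forallP/familyP => h j.
    have := h j; rewrite /colsum; under eq_bigr do rewrite ffunE.
    by [].
  rewrite /colsum; under eq_bigr do rewrite ffunE.
  exact: h.
rewrite exchange_big row_monomial_pair.
by apply: eq_bigr => i _; apply: eq_bigr => j _; rewrite ffunE.
Qed.

Section Step.
Variables (s : 'I_m.+1) (x : 'I_m.+1 -> R).
Hypotheses (s_gt0 : (0 < s)%N) (x_gt0 : forall i, 0 < x i).
Hypothesis sum_alpha : (\sum_i alpha i)%N = S.

(** What is left for the rows up to [s] once the later rows have their prescribed sums, hence the
    largest degree in row [s]. *)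
Let M := (S - \sum_(i < m.+1 | (s < i)%N) alpha i)%N.

Let slice_pred l A := [&& cols_ok A, rows_ok s.+1 A & rowsum A s == l].

Definition slice l : R := \sum_(A | slice_pred l A) row_monomial x A.

Local Notation I := ('I_m.+1 + 'I_n)%type.
(* Rows before [s] are evaluated rather than extracted, so they share a label. *)
Let lab (i : 'I_m.+1) : 'I_m.+1 := if (i < s)%N then ord0 else i.
Let src (o : cell) : I := inl (lab o.1).
Let tgt (o : cell) : I := inr o.2.
Let row (a : I) := if a is inl _ then true else false.

Let g0 : {ffun I -> int} := [ffun a : I => match a with
  | inl i => if (s < i)%N then (alpha i)%:Z else 0
  | inr j => - (beta j)%:Z end].

(** For [l + d = M] this is the margin of the tables in [slice l], with [d] the joint sum of the
    rows before [s]. *)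
Let gl l d : {ffun I -> int} :=
  g0 + unitv (inl s) *+ l + unitv (inl ord0) *+ d.

Let s_neq0 : (s == ord0) = false.
Proof. by apply/eqP => E; move: s_gt0; rewrite E. Qed.

Let Posz_sum (T : finType) (P : pred T) (F : T -> nat) :
  (\sum_(t | P t) F t)%N%:Z = \sum_(t | P t) (F t)%:Z.
Proof. exact: (big_morph Posz PoszD). Qed.

Let margin_row A (i : 'I_m.+1) :
  margin src tgt A (inl i) = (\sum_(i' | lab i' == i) rowsum A i')%N%:Z.
Proof.
rewrite /margin sum_ffunE Posz_sum [RHS]big_mkcond.
transitivity (\sum_i' \sum_j (if lab i' == i then (A (i', j))%:Z else 0)).
  rewrite (pair_bigA _ (fun i' j => if lab i' == i then (A (i', j))%:Z else 0))/=.
  apply: eq_bigr => -[i' j] _; rewrite ffunMnE !ffunE /src /tgt /= subr0.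
  have -> : ((inl i : I) == inl (lab i')) = (lab i' == i) by rewrite eq_sym.
  by case: eqP => _; rewrite ?mul0rn ?natz.
apply: eq_bigr => i' _; case: ifP => _; first by rewrite /rowsum Posz_sum.
by rewrite big1.
Qed.

Let margin_col A j : margin src tgt A (inr j) = - (colsum A j)%:Z.
Proof.
rewrite /margin sum_ffunE /colsum Posz_sum.
transitivity (\sum_i \sum_j' (if j' == j then - (A (i, j'))%:Z else 0)).
  rewrite (pair_bigA _ (fun i j' => if j' == j then - (A (i, j'))%:Z else 0))/=.
  apply: eq_bigr => -[i' j'] _; rewrite ffunMnE !ffunE /src /tgt /= sub0r.
  have -> : ((inr j : I) == inr j') = (j' == j) by rewrite eq_sym.
  by case: eqP => _; rewrite ?oppr0 ?mul0rn ?mulNrn ?natz.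
by rewrite -sumrN; apply: eq_bigr => i _; rewrite -big_mkcond big_pred1_eq.
Qed.

Let glE l d (i : 'I_m.+1) : gl l d (inl i) =
  (if (s < i)%N then (alpha i)%:Z else 0) + ((i == s) * l)%N%:Z + ((i == ord0) * d)%N%:Z.
Proof.
rewrite !ffunE !ffunMnE !ffunE /=.
have E k : ((inl i : I) == inl k) = (i == k) by [].
rewrite !E; congr (_ + _ + _); by case: eqP => _; rewrite ?mul1n ?mul0n ?mul0rn ?natz.
Qed.

Let glEr l d j : gl l d (inr j) = - (beta j)%:Z.
Proof. by rewrite !ffunE !ffunMnE !ffunE /= !mul0rn !addr0. Qed.

Let lab_big (i : 'I_m.+1) (F : 'I_m.+1 -> nat) : (s <= i)%N -> (\sum_(i' | lab i' == i) F i')%N = F i.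
Proof.
move=> si; apply: big_pred1 => i' /=; rewrite /lab; case: ifPn => // lt.
apply/eqP/eqP => [E|E]; last by move: lt; rewrite E ltnNge si.
by move: si; rewrite -E /= leqNgt s_gt0.
Qed.

(** All rows together sum to [S], so fixing the columns and the rows from [s] on forces the joint
    sum of the earlier rows. *)
Let margin_gl l d A : (l + d)%N = M -> (margin src tgt A == gl l d) = slice_pred l A.
Proof.
move=> ldM; have s0 := s_gt0; apply/eqP/idP => [E|].
  have cA : cols_ok A.
    apply/forallP => j; have := margin_col A j; rewrite E glEr => /oppr_inj[->].
    exact: eqxx.
  have rA (i : 'I_m.+1) : (s <= i)%N -> (rowsum A i)%:Z = gl l d (inl i).
    by move=> si; rewrite -E margin_row lab_big.
  have i0 (i : 'I_m.+1) : (s <= i)%N -> (i == ord0) = false.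
    by move=> si; apply/eqP => i0; move: si; rewrite i0 leqNgt s0.
  apply/and3P; split => //.
    apply/forallP => i; apply/implyP => si; have := rA i (ltnW si).
    rewrite glE si i0 1?ltnW// (_ : i == s = false).
      by rewrite !mul0n !addr0 => -[->].
    by apply/eqP => is_; move: si; rewrite is_ ltnn.
  have := rA s (leqnn _); rewrite glE ltnn eqxx i0// mul1n mul0n add0r addr0.
  by move=> [->].
move=> /and3P[cA /forallP rA /eqP rs]; apply/ffunP => -[i|j]; last first.
  by rewrite margin_col glEr; move/forallP/(_ j)/eqP: cA => ->.
rewrite margin_row glE.
have [is_|si|is_] := ltngtP i s.
- have -> : (i == s) = false by apply/eqP => E; move: is_; rewrite E ltnn.
  rewrite mul0n !add0r.
  have [->|i0] := eqVneq i ord0; last first.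
    rewrite mul0n big_pred0// => i'; rewrite /lab; case: ifP => [_|].
      by rewrite eq_sym; exact: negbTE.
    by move=> lt; apply/eqP => E; move: is_; rewrite -E lt.
  rewrite mul1n; congr Posz.
  have := sum_rowsum cA; rewrite (bigID (fun i' : 'I_m.+1 => (i' < s)%N))/=.
  have -> : (\sum_(i' < m.+1 | ~~ (i' < s)%N) rowsum A i' =
      l + \sum_(i < m.+1 | (s < i)%N) alpha i)%N.
    rewrite (bigD1 s)/= ?ltnn// rs; congr (_ + _)%N; apply: eq_big => i'.
      by rewrite -leqNgt [(s < i')%N]ltn_neqAle andbC eq_sym.
    rewrite -leqNgt => /andP[h1 h2]; apply/eqP; have := rA i'.
    by rewrite ltn_neqAle eq_sym h1 h2.
  have -> : (\sum_(i' < m.+1 | (i' < s)%N) rowsum A i' =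
      \sum_(i' | lab i' == ord0) rowsum A i')%N.
    apply: eq_bigl => i'; rewrite /lab; case: ifPn => // lt; apply/esym/eqP => E.
    by move: lt; rewrite E s0.
  have key X Y : (X + (l + Y))%N = S -> (l + d)%N = (S - Y)%N -> X = d by lia.
  by move=> /key; apply.
- rewrite lab_big 1?ltnW//; have := rA i; rewrite si => /eqP ->.
  have -> : (i == s) = false by apply/eqP => E; move: si; rewrite E ltnn.
  have -> : (i == ord0) = false by apply/eqP => E; move: si; rewrite E.
  by rewrite !mul0n !addr0.
- have {is_}-> : i = s by exact: val_inj.
  by rewrite lab_big// rs eqxx s_neq0 mul1n mul0n add0r addr0.
Qed.

Let sliceE l d : (l + d)%N = M -> slice l = table_sum src tgt (fun o => x o.1) N (gl l d).
Proof. by move=> ldM; apply: eq_bigl => A; rewrite margin_gl. Qed.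

Let M_le : (M <= S)%N. Proof. exact: leq_subr. Qed.

Let slice_log_concave l : (l.+2 <= M)%N -> slice l * slice l.+2 <= slice l.+1 ^+ 2.
Proof.
(* Here [l + d = M - 2]: two units placed at [s] or at the shared label [ord0] produce three
   consecutive slices. *)
move=> lM; pose d := (M - l.+2)%N.
rewrite (@sliceE l d.+2) 1?(@sliceE l.+2 d) 1?(@sliceE l.+1 d.+1); try (rewrite /d; lia).
have g1 : gl l d.+2 = gl l d + unitv (inl ord0) + unitv (inl ord0).
  by rewrite /gl !mulrSr !addrA.
have g2 : gl l.+2 d = gl l d + unitv (inl s) + unitv (inl s).
  by rewrite /gl !mulrSr; apply/ffunP => t; rewrite !ffunE; ring.
have g3 : gl l.+1 d.+1 = gl l d + unitv (inl ord0) + unitv (inl s).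
  by rewrite /gl !mulrSr; apply/ffunP => t; rewrite !ffunE; ring.
rewrite g1 g2 g3; apply: (@table_sum_log_concave _ _ _ row) => //.
  by apply/rows_ge0P => -[i|//] _; rewrite glE; case: ifP.
move=> [i|//] _; rewrite glE.
have h : (if (s < i)%N then alpha i else 0)%N%:Z = (if (s < i)%N then (alpha i)%:Z else 0) by case: ifP.
rewrite -h; have hi : ((if (s < i)%N then alpha i else 0) + (i == s) * l + (i == ord0) * d <= S)%N.
  have aS : (alpha i <= S)%N by rewrite -sum_alpha (bigD1 i)//= leq_addr.
  case: ifPn => si.
    have -> : (i == s) = false by apply/eqP => E; move: si; rewrite E ltnn.
    have -> : (i == ord0) = false by apply/eqP => E; move: si; rewrite E.
    by rewrite !mul0n !addn0.
  have -> : (i == s) = (i == s) && (i != ord0).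
    by case: eqP => // ->; rewrite s_neq0.
  have := M_le; rewrite /d; case: (i == ord0); case: (i == s); rewrite /=; lia.
by rewrite -!PoszD lez_nat /N -(addn2 S) leq_add2r.
Qed.

Let slice_gt0 l : (l <= M)%N -> 0 < slice l.
Proof.
move=> lM.
have aS : (\sum_(i < m.+1 | (s < i)%N) alpha i <= S)%N.
  by rewrite -sum_alpha [leqRHS](bigID (fun i : 'I_m.+1 => (s < i)%N))/= leq_addr.
(* Row sums of a witness table: row [ord0] absorbs what row [s] leaves of [M], and the rows strictly
   between are empty. *)
pose a (i : 'I_m.+1) := (if i == ord0 then M - l else if i == s then l else
  if (s < i)%N then alpha i else 0)%N.
have [B [rB cB]] : exists B : 'I_m.+1 -> 'I_n -> nat,
    (forall i, (\sum_j B i j)%N = a i) /\ (forall j, (\sum_i B i j)%N = beta j).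
  apply: contingency_table_exists; rewrite -/S (bigD1 ord0)//= (bigD1 s)/= ?s_neq0//.
  rewrite {1 2}/a eqxx s_neq0 eqxx.
  have -> : (\sum_(i < m.+1 | (i != ord0) && (i != s)) a i =
      \sum_(i < m.+1 | (s < i)%N) alpha i)%N.
    rewrite big_mkcond [RHS]big_mkcond; apply: eq_bigr => i _; rewrite /a.
    have [->|i0] /= := eqVneq i ord0; first by [].
    by have [->|] //= := eqVneq i s; rewrite ltnn.
  by move: lM; rewrite /M; lia.
have BN i j : (B i j < N.+1)%N.
  rewrite ltnS /N ltnW// ltnW// ltnS /S (bigD1 j)//= -(cB j) (bigD1 i)//= -addnA.
  exact: leq_addr.
pose A : {ffun cell -> 'I_N.+1} := [ffun o => inord (B o.1 o.2)].
have AE i j : A (i, j) = B i j :> nat by rewrite ffunE inordK.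
have rA i : rowsum A i = a i.
  by rewrite /rowsum -rB; apply: eq_bigr => j _; rewrite AE.
have cA j : colsum A j = beta j.
  by rewrite /colsum -cB; apply: eq_bigr => i _; rewrite AE.
have tx A' : 0 < row_monomial x A' by apply: prodr_gt0 => o _; exact: exprn_gt0.
rewrite /slice (bigD1 A)/=; last first.
  apply/and3P; split; first by apply/forallP => j; rewrite cA.
    apply/forallP => i; apply/implyP => si; rewrite rA /a si.
    have -> : (i == s) = false by apply/eqP => E; move: si; rewrite E ltnn.
    by have -> : (i == ord0) = false by apply/eqP => E; move: si; rewrite E.
  by rewrite rA /a s_neq0 eqxx.
by rewrite ltr_pwDl// sumr_ge0// => A' _; exact/ltW.
Qed.

(** Since [x s = 1], substituting [t] for it turns the left side into the sum of [slice l * t ^+ l],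
    while [partial_gf s x] is the single coefficient [slice (alpha s)]. *)
Lemma row_extraction : x s = 1 -> exists2 t : R, 0 < t &
  partial_gf s.+1 (fun i => if i == s then t else x i) <=
  expR 1 * (alpha s).+1%:R * (partial_gf s x * t ^+ alpha s).
Proof.
move=> xs.
have aS : (\sum_(i < m.+1 | (s <= i)%N) alpha i <= S)%N.
  by rewrite -sum_alpha [leqRHS](bigID (fun i : 'I_m.+1 => (s <= i)%N))/= leq_addr.
have aM : (alpha s <= M)%N.
  move: aS; rewrite (bigD1 s)//=.
  have -> : (\sum_(i < m.+1 | (s <= i)%N && (i != s)) alpha i =
      \sum_(i < m.+1 | (s < i)%N) alpha i)%N.
    by apply: eq_bigl => i; rewrite [(s < i)%N]ltn_neqAle andbC eq_sym.
  by rewrite /M; lia.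
have [t t0 h] := log_concave_capacity aM slice_gt0 slice_log_concave.
exists t => //.
have -> : partial_gf s x = slice (alpha s).
  apply: eq_bigl => A; rewrite /slice_pred; congr (_ && _).
  apply/forallP/andP => [rA|[/forallP rA rs] i].
    split; last by have := rA s; rewrite leqnn.
    by apply/forallP => i; apply/implyP => si; have := rA i; rewrite ltnW.
  apply/implyP; rewrite leq_eqVlt => /orP[/eqP/val_inj <-//|si].
  by have := rA i; rewrite si.
apply: le_trans h; rewrite le_eqVlt; apply/orP; left; apply/eqP.
(* The degree in row [s] never exceeds [M], so the sum over [l] misses no table. *)
have rowsum_lt A : cols_ok A -> rows_ok s.+1 A -> (rowsum A s < M.+1)%N.
  move=> cA rA.
  have := sum_rowsum cA; rewrite (bigID (fun i : 'I_m.+1 => (s < i)%N))/=.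
  have -> : (\sum_(i < m.+1 | (s < i)%N) rowsum A i =
    \sum_(i < m.+1 | (s < i)%N) alpha i)%N.
    by apply: eq_bigr => i si; move/forallP/(_ i): rA; rewrite si => /eqP.
  have key X Y Z : (Y + (X + Z))%N = S -> (X < (S - Y).+1)%N by lia.
  by rewrite [X in (_ + X)%N](bigD1 s)/= ?ltnn// => /key.
pose deg A : 'I_M.+1 := inord (rowsum A s).
rewrite /partial_gf (partition_big deg predT)//=; apply: eq_bigr => l _.
rewrite mulr_suml; apply: eq_big => [A|A].
  rewrite /slice_pred -andbA.
  have [cA|//] := boolP (cols_ok A); have [rA|//] /= := boolP (rows_ok s.+1 A).
  by rewrite -val_eqE /= inordK// rowsum_lt.
move=> /andP[/andP[cA rA] /eqP dA].
have rl : rowsum A s = l by rewrite -dA inordK// rowsum_lt.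
rewrite !row_monomialE (bigD1 s)//= eqxx [in RHS](bigD1 s)//= xs expr1n mul1r rl mulrC.
by congr (_ * _); apply: eq_bigr => i /negbTE ->.
Qed.
End Step.

(** Coordinates are chosen by increasing row: rows from [s] on have fixed sums in [partial_gf s], so
    their coordinates may stay at 1 until their turn. Row [ord0] is never extracted. *)
Lemma rows_extraction s : (0 < s <= m.+1)%N -> (\sum_i alpha i)%N = S ->
  exists x : 'I_m.+1 -> R, [/\ forall i, 0 < x i, x ord0 = 1,
    forall i : 'I_m.+1, (s <= i)%N -> x i = 1 &
    partial_gf s x <= (\prod_(i < m.+1 | (0 < i < s)%N)
      (expR 1 * (alpha i).+1%:R * x i ^+ alpha i)) * partial_gf 1 (fun=> 1)].
Proof.
move=> + sa; elim: s => // s IH.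
have [->|s0] := posnP s.
  move=> _; exists (fun=> 1); split => //; rewrite big_pred0 ?mul1r// => i.
  by case: (val i).
move=> /= sm; case: IH => [|x [x0 x1 xs h]]; first by rewrite s0 ltnW.
pose s' : 'I_m.+1 := Ordinal sm.
have [t t0 ht] := @row_extraction s' x s0 x0 sa (xs s' (leqnn _)).
exists (fun i => if i == s' then t else x i); split => [i||i si|].
- by case: ifP.
- by case: eqP => // E; move: s0; rewrite -[s]/(val s') -E.
- by case: eqP => [E|_]; [move: si; rewrite E ltnn | rewrite xs// ltnW].
apply: le_trans ht _.
rewrite (bigD1 s')/= ?s0 ?ltnSn// eqxx.
have -> : \prod_(i < m.+1 | (0 < i < s.+1)%N && (i != s'))
      (expR 1 * (alpha i).+1%:R * (if i == s' then t else x i) ^+ alpha i) =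
    \prod_(i < m.+1 | (0 < i < s)%N) (expR 1 * (alpha i).+1%:R * x i ^+ alpha i).
  apply: eq_big => [i|i /andP[_ /negbTE->//]].
  by rewrite -val_eqE /=; lia.
rewrite -!mulrA !ler_pM2l ?expR_gt0// mulrC ler_pM2l ?exprn_gt0//.
Qed.

End RowExtraction.

(** * Capacity and contingency tables *)

Section Capacity.
Variables (R : realType) (m n : nat) (alpha : 'I_m.+1 -> nat) (beta : 'I_n.+1 -> nat).
Hypothesis sum_eq : (\sum_i alpha i)%N = (\sum_j beta j)%N.
Let S := (\sum_j beta j)%N.
Let N := S.+2.
Local Notation table := {ffun 'I_m.+1 * 'I_n.+1 -> 'I_N.+1}.
Variable K : 'M[nat]_(m.+1, n.+1).
Hypothesis K_def : forall i j, K i j = minn (alpha i) (beta j).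

Definition is_table (A : {ffun 'I_m.+1 * 'I_n.+1 -> 'I_N.+1}) :=
  cols_ok A && rows_ok alpha 0 A.

Lemma CT_card : CT alpha beta = #|is_table|.
Proof.
pose f (A : table) : 'M[nat]_(m.+1, n.+1) := \matrix_(i, j) (A (i, j) : nat).
have f_inj : injective f.
  move=> A B /matrixP E; apply/ffunP => -[i j]; apply: val_inj.
  by have := E i j; rewrite !mxE.
suff -> : CT alpha beta = #|` [fset f A | A in enum is_table]%fset|.
  by rewrite card_imfset//= undup_id ?enum_uniq -?cardE.
rewrite /CT; congr (#|` _|)%fset; apply/fsetP => B.
rewrite in_fset_set; last exact: finite_contingency_tables.
apply/idP/imfsetP => [|[A /=]]; last rewrite mem_enum => /andP[/forallP cA /forallP rA] ->.
  rewrite inE => -[rB cB].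
  have BN i j : (B i j < N.+1)%N.
    rewrite ltnS /N ltnW// ltnW// ltnS /S (bigD1 j)//= -(cB j) (bigD1 i)//= -addnA.
    exact: leq_addr.
  pose A : table := [ffun o => inord (B o.1 o.2)].
  have AE i j : A (i, j) = B i j :> nat by rewrite ffunE inordK.
  exists A; rewrite /= ?mem_enum; last by apply/matrixP => i j; rewrite mxE AE.
  apply/andP; split; apply/forallP.
    by move=> j; rewrite -cB; apply/eqP; apply: eq_bigr => i _; rewrite AE.
  by move=> i; rewrite -rB; apply/eqP; apply: eq_bigr => j _; rewrite AE.
rewrite inE; split => [i|j].
  by have /= /eqP <- := rA i; apply: eq_bigr => j _; rewrite mxE.
by have /= /eqP <- := cA j; apply: eq_bigr => i _; rewrite mxE.
Qed.

(** The sum of row [ord0] is forced by the other margins and [sum_eq]. *)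
Lemma partial_gf1 : partial_gf alpha beta 1 (fun=> 1 : R) = (CT alpha beta)%:R.
Proof.
rewrite CT_card -sum1_card natr_sum; apply: eq_big => [A|A _]; last first.
  by rewrite /row_monomial big1// => o _; rewrite expr1n.
rewrite unfold_in /is_table; have [cA|//] /= := boolP (cols_ok A).
apply/forallP/forallP => /= rA i; last by apply/implyP => _; exact: rA.
have rE k : k != ord0 -> rowsum A k = alpha k.
  by move=> k0; have := rA k; rewrite lt0n -val_eqE in k0 *; rewrite k0 => /eqP.
have [->|/rE/eqP//] := eqVneq i ord0.
have := etrans (sum_rowsum cA) (esym sum_eq); rewrite (bigD1 ord0)//= [in RHS](bigD1 ord0)//=.
by rewrite (eq_bigr _ rE) => /addIn ->.
Qed.

Lemma CT_le_value (x : 'I_m.+1 -> R) (y : 'I_n.+1 -> R) :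
  (forall i, 0 < x i) -> (forall j, 0 < y j) ->
  (CT alpha beta)%:R <=
  P_ K x y * (\prod_i x i ^- alpha i) * (\prod_j y j ^- beta j).
Proof.
move=> x0 y0; rewrite !prodfV -mulrA -invfM ler_pdivlMr; last first.
  by rewrite mulr_gt0// prodr_gt0// => i _; rewrite exprn_gt0.
have KN (o : 'I_m.+1 * 'I_n.+1) : (K o.1 o.2 <= N)%N.
  rewrite K_def (leq_trans (geq_minr _ _))// /N ltnW// ltnW// ltnS /S.
  by rewrite (bigD1 o.2)//= leq_addr.
rewrite /P_ (pair_bigA _ (fun i j => \sum_(l < (K i j).+1) x i ^+ l * y j ^+ l))/=.
rewrite (prod_sum_trunc (fun o l => x o.1 ^+ l * y o.2 ^+ l) KN).
rewrite CT_card -sum1_card natr_sum mulr_suml.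
rewrite [leLHS]big_mkcond [leRHS]big_mkcond; apply: ler_sum => A _ /=.
have P0 : 0 < \prod_o (x o.1 ^+ A o * y o.2 ^+ A o).
  by apply: prodr_gt0 => o _; rewrite mulr_gt0// exprn_gt0.
case: ifPn => [|_]; last by case: ifP => // _; rewrite ltW.
rewrite unfold_in => /andP[/forallP /= cA /forallP /= rA].
(* An entry is at most its row sum and its column sum, so every table occurs in the expansion of
   [P_ K]. *)
rewrite mul1r ifT; last first.
  apply/forallP => -[i j]; rewrite K_def leq_min /=.
  have /eqP <- := rA i; have /eqP <- := cA j.
  by rewrite /rowsum /colsum (bigD1 j)//= leq_addr (bigD1 i)//= leq_addr.
rewrite big_split /= -/(row_monomial x A) row_monomialE.
have -> : \prod_o y o.2 ^+ A o = \prod_j y j ^+ beta j.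
  transitivity (\prod_i \prod_j y j ^+ A (i, j)).
    by rewrite pair_bigA; apply: eq_bigr => -[].
  rewrite exchange_big; apply: eq_bigr => j _.
  by have /eqP <- := cA j; rewrite prodrXr.
rewrite (_ : \prod_i x i ^+ rowsum A i = \prod_i x i ^+ alpha i)//.
by apply: eq_bigr => i _; have /eqP <- := rA i.
Qed.

Let A0 := (\sum_(i | i != ord0) alpha i)%N.

(** The loss at column [j]. In the final estimate the sum of column [ord0] has no bound by [c],
    whereas [A0] is at most [m * c]. *)
Let kappa (j : 'I_n.+1) : R := expR 1 * (if j == ord0 then A0.+1 else (beta j).+1)%:R.

Lemma column_extraction (x : 'I_m.+1 -> R) j :
  (forall i, 0 < x i) -> x ord0 = 1 -> exists2 y : R, 0 < y &
  \prod_i \sum_(l < (K i j).+1) x i ^+ l * y ^+ l <=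
  kappa j * (hsym N x (beta j) * y ^+ beta j).
Proof.
move=> x0 x1.
have KN : (\sum_i K i j <= N)%N.
  rewrite /N ltnW// ltnW// ltnS /S -sum_eq; apply: leq_sum => i _.
  by rewrite K_def geq_minl.
have bN : (beta j <= N)%N.
  by rewrite /N ltnW// ltnW// ltnS /S (bigD1 j)//= leq_addr.
have [y y0 hy] := hsym_capacity x0 KN bN.
rewrite /kappa; have [jE|_] := eqVneq j ord0; last by exists y.
(* When the column sum is at most [A0] the general factor is already small enough; otherwise the
   other rows cannot fill the column. *)
have [bA|Ab] := leqP (beta j) A0.
  exists y => //; apply: le_trans hy _.
  rewrite ler_wpM2r ?ler_pM2l ?expR_gt0 ?ler_nat//.
  by rewrite mulr_ge0 ?exprn_ge0 ?(ltW y0)// ltW// hsym_gt0.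
apply: hsym_capacity_large => //.
- by rewrite K_def geq_minr.
- by apply: leq_sum => i _; rewrite K_def geq_minl.
- by rewrite (ltnW Ab).
Qed.

(** The point [x] is fixed first by the row extraction, and each [y j] is then chosen for that [x];
    the column bounds meet the row bounds at [partial_gf m.+1 x]. *)
Lemma value_le_CT : exists x : 'I_m.+1 -> R, exists y : 'I_n.+1 -> R,
  [/\ forall i, 0 < x i, forall j, 0 < y j &
  P_ K x y * (\prod_i x i ^- alpha i) * (\prod_j y j ^- beta j) <=
  (\prod_j kappa j) *
  (\prod_(i | i != ord0) (expR 1 * (alpha i).+1%:R)) * (CT alpha beta)%:R].
Proof.
have [|x [x0 x1 _ hx]] := @rows_extraction R m n.+1 alpha beta m.+1 _ sum_eq.
  by rewrite leqnn.
have /choice[y hy] : forall j, exists y : R, 0 < y /\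
  \prod_i \sum_(l < (K i j).+1) x i ^+ l * y ^+ l <=
  kappa j * (hsym N x (beta j) * y ^+ beta j).
  by move=> j; have [y y0 h] := column_extraction j x0 x1; exists y.
exists x, y; split => // [j|]; first by have [] := hy j.
rewrite !prodfV ler_pdivrMr; last first.
  by apply: prodr_gt0 => j _; rewrite exprn_gt0//; have [] := hy j.
rewrite ler_pdivrMr; last by apply: prodr_gt0 => i _; rewrite exprn_gt0.
apply: (@le_trans _ _ (\prod_j (kappa j * (hsym N x (beta j) * y j ^+ beta j)))).
  rewrite /P_ exchange_big; apply: ler_prod => j _; have [y0 ->] := hy j.
  rewrite andbT; apply: prodr_ge0 => i _; apply: sumr_ge0 => l _.
  by rewrite mulr_ge0// exprn_ge0// ltW.
rewrite [leLHS]big_split [X in _ * X <= _]big_split /= -(partial_gf_full alpha).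
set Y := \prod_j y j ^+ beta j; set k := \prod_j kappa j.
have Y0 : 0 < Y by apply: prodr_gt0 => j _; rewrite exprn_gt0//; have [] := hy j.
have k0 : 0 < k.
  by apply: prodr_gt0 => j _; rewrite mulr_gt0 ?expR_gt0 ?ltr0n//; case: ifP.
have xE : \prod_i x i ^+ alpha i = \prod_(i | i != ord0) x i ^+ alpha i.
  by rewrite (bigD1 ord0)//= x1 expr1n mul1r.
move: hx; rewrite partial_gf1.
have -> : \prod_(i < m.+1 | (0 < i < m.+1)%N) (expR 1 * (alpha i).+1%:R * x i ^+ alpha i) =
  \prod_(i | i != ord0) (expR 1 * (alpha i).+1%:R) * \prod_i x i ^+ alpha i.
  rewrite xE -big_split; apply: eq_bigl => i.
  by rewrite ltn_ord andbT lt0n.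
set E := \prod_(i | _) _; set X := \prod_i _ => hx.
rewrite (_ : _ * Y * X = k * (E * X * (CT alpha beta)%:R * Y)); last by ring.
by rewrite ler_pM2l// ler_pM2r.
Qed.

(** There are [n + 1] column factors and [m] row factors, each at most [expR 1 * (c + 1)] except the
    one of column [ord0]. *)
Lemma extraction_constant_le (c : R) : 0 <= c ->
  (forall i : 'I_m.+1, (1 <= i)%N -> (alpha i)%:R <= c) ->
  (forall j : 'I_n.+1, (1 <= j)%N -> (beta j)%:R <= c) ->
  (\prod_j kappa j) * (\prod_(i | i != ord0) (expR 1 * (alpha i).+1%:R)) <=
  (m.+1 + n.+1 - 1)%N%:R * (expR 1 * (c + 1)) ^+ (m.+1 + n.+1 - 1).
Proof.
move=> c0 ac bc; set e := expR 1 * (c + 1).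
have e0 : 0 <= e by rewrite mulr_ge0 ?expR_ge0// addr_ge0.
have card k : #|[pred i : 'I_k.+1 | i != ord0]| = k.
  by rewrite (@eq_card _ _ (predC1 ord0))// cardC1 card_ord.
have bnd (k : nat) (f : 'I_k.+1 -> nat) :
    (forall i : 'I_k.+1, (1 <= i)%N -> (f i)%:R <= c) ->
    \prod_(i | i != ord0) (expR 1 * (f i).+1%:R) <= e ^+ k.
  move=> fc; rewrite -[k in e ^+ k]card -prodr_const; apply: ler_prod => i i0.
  rewrite mulr_ge0 ?expR_ge0//= ler_pM2l ?expR_gt0// -natr1 lerD2r fc//.
  by rewrite lt0n.
rewrite (bigD1 ord0)//= {1}/kappa eqxx.
have -> : \prod_(j | j != ord0) kappa j = \prod_(j | j != ord0) (expR 1 * (beta j).+1%:R).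
  by apply: eq_bigr => j /negbTE j0; rewrite /kappa j0.
(* The linear factor of the constant arises here: [A0] is a sum of [m] terms, each at most [c]. *)
have A0c : A0.+1%:R <= (m.+1 + n.+1 - 1)%N%:R * (c + 1).
  have A0m : A0%:R <= m%:R * c.
    rewrite /A0 natr_sum mulr_natl -[m in leRHS]card -sumr_const.
    by apply: ler_sum => i i0; rewrite ac// lt0n.
  have -> : (m.+1 + n.+1 - 1 = m + n.+1)%N by lia.
  rewrite -natr1 natrD -natr1.
  have := ler0n R m; have := ler0n R n; nra.
have mnE : (m.+1 + n.+1 - 1 = (n + m).+1)%N by lia.
rewrite mnE in A0c *.
rewrite exprS exprD (mulrA _ e) (mulrA _ (e ^+ n)); apply: ler_pM.
- apply: mulr_ge0; first by rewrite mulr_ge0 ?expR_ge0.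
  by apply: prodr_ge0 => j _; rewrite mulr_ge0 ?expR_ge0.
- by apply: prodr_ge0 => i _; rewrite mulr_ge0 ?expR_ge0.
- apply: ler_pM.
  + by rewrite mulr_ge0 ?expR_ge0.
  + by apply: prodr_ge0 => i _; rewrite mulr_ge0 ?expR_ge0.
  + by rewrite /e mulrCA ler_pM2l ?expR_gt0.
  + exact: bnd.
- exact: bnd.
Qed.

End Capacity.

(* Indices are 0-based: the rows and columns with index i, j >= 2 of the      *)
(* paper are those with 1 <= i, j here.                                       *)
Theorem theorem2p3 (R : realType) (m n : nat) (m_gt0 : (0 < m)%N)
    (n_gt0 : (0 < n)%N) (alpha : 'I_m -> nat) (beta : 'I_n -> nat)
    (sum_eq : (\sum_(i < m) alpha i)%N = (\sum_(j < n) beta j)%N)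
    (c : R) (c_ge0 : 0 <= c)
    (alpha_le : forall i : 'I_m, (1 <= i)%N -> (alpha i)%:R <= c)
    (beta_le : forall j : 'I_n, (1 <= j)%N -> (beta j)%:R <= c)
    (K : 'M[nat]_(m, n))
    (K_def : forall i j, K i j = minn (alpha i) (beta j)) :
  cap alpha beta (@P_ R m n K) >= (CT alpha beta)%:R /\
  (CT alpha beta)%:R >=
    1 / ((m + n - 1)%N%:R * (expR 1 * (c + 1)) ^+ (m + n - 1)) *
    cap alpha beta (@P_ R m n K).
Proof.
case: m n m_gt0 n_gt0 alpha beta sum_eq alpha_le beta_le K K_def => [//|m] [//|n] _ _.
move=> alpha beta sum_eq alpha_le beta_le K K_def.
have [ne lb] := @has_inf_cap_values R _ _ alpha beta K.
split.
  apply: lb_le_inf => // _ [x [y [x0 y0 ->]]].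
  exact: CT_le_value.
have [x [y [x0 y0 h]]] := value_le_CT R sum_eq K_def.
set D := _%:R * _ ^+ _.
have D0 : 0 < D.
  by rewrite mulr_gt0 ?ltr0n ?exprn_gt0 ?mulr_gt0 ?expR_gt0 ?ltr_wpDl//; lia.
rewrite mul1r ler_pdivrMl//.
apply: le_trans (ge_inf lb _) _; first by exists x, y; split.
apply: le_trans h _; rewrite ler_wpM2r//.
exact: extraction_constant_le.
Qed.
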